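(* Let $p$ be a prime, let $V_1,V_2$ be $\mathbb{F}_p$-vector spaces, and let $P\subset V_1\times V_2$ be a transverse set. Suppose that for every $x\in V_1$ the fiber $P_{x\cdot}$ is a subspace of $V_2$ with $\operatorname{codim}_{V_2}P_{x\cdot}\le 1$. Then one of the following three alternatives holds. (1) There exist a subset $W\subset V_1$ which is empty or a linear subspace, and a hyperplane $H\le V_2$, such that $P=(W\times V_2)\cup(V_1\times H)$. (2) There exists a bilinear form $b$ on $V_1\times V_2$ such that $P=\{(x,y)\in V_1\times V_2: b(x,y)=0\}$. (3) We have $p\ge 5$, and the minimal codimension of a linear subspace $W\le V_1$ such that $W\times V_2\subset P$ is exactly $2$.
   Context: For $P\subset V_1\times V_2$ define the vertical sum $P\stackrel{V}{+}P=\{(x,y_1+y_2):(x,y_1),(x,y_2)\in P\}$ and the horizontal sum $P\stackrel{H}{+}P=\{(x_1+x_2,y):(x_1,y),(x_2,y)\in P\}$. The set $P$ is called transverse if $P\stackrel{V}{+}P=P\stackrel{H}{+}P=P$. For $x\in V_1$, the vertical fiber is $P_{x\cdot}=\{y\in V_2:(x,y)\in P\}$; for a transverse set, a nonempty fiber is always a linear subspace. A hyperplane is a linear subspace of codimension 1. *)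

(* Defs.v *)
From HB Require Import structures.
From mathcomp Require Import all_boot all_order all_algebra.
From mathcomp Require Import boolp classical_sets.

Set Implicit Arguments.
Unset Strict Implicit.
Unset Printing Implicit Defensive.

Import GRing.Theory.

Local Open Scope ring_scope.
Local Open Scope classical_set_scope.

Section Sums.
Variables V1 V2 : zmodType.
Implicit Type P : set (V1 * V2).

Definition vertical_sum P : set (V1 * V2) :=
  [set z | exists y1 y2, [/\ P (z.1, y1), P (z.1, y2) & z.2 = y1 + y2]].

Definition horizontal_sum P : set (V1 * V2) :=
  [set z | exists x1 x2, [/\ P (x1, z.2), P (x2, z.2) & z.1 = x1 + x2]].

Definition transverse P : Prop :=
  vertical_sum P = P /\ horizontal_sum P = P.

End Sums.

Section Codimension.
Variables (K : fieldType) (V : lmodType K).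

Definition subspace (W : set V) : Prop := submod_closed (mem W).

(* dim (V / W) = d : the images in V / W of some d vectors form a basis. The
   ambient space need not be finite-dimensional; if V / W is infinite-dimensional,
   then has_codim W d holds for no d. *)
Definition has_codim (W : set V) (d : nat) : Prop :=
  exists e : 'I_d -> V,
    forall v : V, exists! c : 'rV[K]_d, W (v - \sum_(i < d) c 0 i *: e i).

Definition codim_le (W : set V) (d : nat) : Prop :=
  exists2 k, (k <= d)%N & has_codim W k.

Definition hyperplane (H : set V) : Prop := subspace H /\ has_codim H 1.

End Codimension.

Section MinimalCodimension.
Variables (K : fieldType) (V1 V2 : lmodType K).
Implicit Type P : set (V1 * V2).

Definition left_factor P (W : set V1) : Prop :=
  subspace W /\ W `*` [set: V2] `<=` P.

Definition min_left_codim P (d : nat) : Prop :=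
  (exists2 W, left_factor P W & has_codim W d) /\
  (forall W k, left_factor P W -> has_codim W k -> (d <= k)%N).

End MinimalCodimension.

(* Main.v *)
Require Import Defs.
From HB Require Import structures.
From mathcomp Require Import all_boot all_order all_algebra.
From mathcomp Require Import boolp classical_sets.
From mathcomp Require Import ring.

Set Implicit Arguments.
Unset Strict Implicit.
Unset Printing Implicit Defensive.

Import GRing.Theory.

Local Open Scope ring_scope.
Local Open Scope classical_set_scope.

(** Write each fiber as the kernel of a linear functional [f x] on [V2], so that
    [P] is the set where [f x y = 0]; [f x] is unique up to a nonzero scalar.
    Closure under horizontal sums says that [f (c x + d x')] is a combination of
    [f x] and [f x']: up to scalars, [f] is a map of projective spaces that
    respects lines. The proof follows the fundamental theorem of projective
    geometry, except that [f] may have zeros, and that injectivity modulo these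
    zeros has to be proved.

    If all nonzero [f x] are proportional, with common kernel [H], then [P] is
    [W x V2] together with [V1 x H], where [W] is the set of zeros of [f]. This
    is the first alternative; if there are no nonzero [f x], then [P] is
    everything, the zero set of the zero form.

    Otherwise a count on lines (line_meets) shows that a line joining two points
    with nonproportional functionals maps onto the whole pencil that they span.
    Two proportional nonzero functionals then come from points that are
    proportional modulo [W] (fiber_line): a coincidence on one line would
    propagate across a plane to a third, different functional.

    Now choose [a], [y0] with [f a y0 <> 0] and the horizontal fiber
    [U = {u | f u y0 = 0}], which is a complement of the line through [a]. On
    the affine chart [a + U] the functionals can be normalized by their value at
    [y0]; the displacement from [a] is [slope u]. It has the same kernel as
    [f u], and the bilinear form sought is
    [(x, y) |-> k x * (f a y / f a y0) + slope (x - k x *: a) y], where [k x] is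
    the coordinate of [x] along [a]. All that matters is whether [slope] is
    additive on [U]. The parallelogram rule gives this for vectors with
    nonproportional slopes, and an auxiliary third direction gives the rest
    when the slopes span more than a line (slope_additive_rank3). When they span
    a line, that of [slope b], then [V1 / W] has dimension exactly 2 and
    [slope (c *: b) = t c * slope b] for an injection [t] of the field that fixes
    0 and 1. For [p <= 3] this forces [t] to be the identity
    (slope_additive_small); for [p >= 5] it does not, and this is the third
    alternative (min_left_codim_rank2). *)

(** * Linear functionals and bilinear forms *)

Section Functionals.
Variables (K : fieldType) (V : lmodType K).

Lemma scalarBZ (g : {scalar V}) y c z : g (y - c *: z) = g y - c * g z.
Proof. by rewrite linearB linearZ. Qed.

Lemma scalar_factor (g h : {scalar V}) :
  (forall y, g y = 0 -> h y = 0) -> exists s, forall y, h y = s * g y.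
Proof.
move=> gh; have [[z gz]|g0] := pselect (exists z, g z != 0); last first.
  exists 0 => y; rewrite mul0r; apply: gh.
  by apply/eqP/negPn/negP => gy; apply: g0; exists y.
exists (h z / g z) => y.
have := gh (y - (g y / g z) *: z).
rewrite !scalarBZ divfK // subrr => /(_ erefl)/eqP.
by rewrite subr_eq0 => /eqP ->; ring.
Qed.

End Functionals.

Lemma bilinear_of_bilinear_for (K : fieldType) (U V : lmodType K)
    (B : U -> V -> K) : bilinear_for *%R *%R B ->
  exists M : {bilinear U -> V -> K | *%R & *%R}, forall x y, M x y = B x y.
Proof.
move=> B_bil.
pose B_mixin := bilinear_isBilinear.Build K U V K *%R *%R B B_bil.
by exists (HB.pack B B_mixin : {bilinear U -> V -> K | *%R & *%R}).
Qed.

Lemma small_field_inj_id (K : finFieldType) (t : K -> K) :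
  (#|K| <= 3)%N -> injective t -> t 0 = 0 -> t 1 = 1 -> t =1 id.
Proof.
move=> K3 t_inj t0 t1 c; apply/eqP/negPn/negP => tc /=.
have c0 : c != 0 by apply: contra_neq tc => ->.
have c1 : c != 1 by apply: contra_neq tc => ->.
have tc0 : t c != 0 by rewrite -t0 (inj_eq t_inj).
have tc1 : t c != 1 by rewrite -t1 (inj_eq t_inj).
suff /card_uniqP card4 : uniq [:: 0; 1; c; t c].
  by have := leq_trans (max_card (mem [:: 0; 1; c; t c])) K3; rewrite card4.
rewrite /= !inE ![1 == _]eq_sym ![0 == _]eq_sym [c == _]eq_sym.
by rewrite oner_eq0 !negb_or c0 c1 tc0 tc1 tc.
Qed.

(** * Families of functionals that respect lines *)

Section Incidence.
Variables (K : finFieldType) (V1 V2 : lmodType K) (f : V1 -> {scalar V2}).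
Hypothesis fD : forall x x' y, f x y = 0 -> f x' y = 0 -> f (x + x') y = 0.
Hypothesis fZ : forall c x y, f x y = 0 -> f (c *: x) y = 0.

Let fB x x' y : f x y = 0 -> f x' y = 0 -> f (x - x') y = 0.
Proof. by move=> xy x'y; rewrite -scaleN1r; apply: fD => //; apply: fZ. Qed.

Let fZK c x y : c != 0 -> f (c *: x) y = 0 -> f x y = 0.
Proof. by move=> c0 /(fZ c^-1); rewrite scalerA mulVf // scale1r. Qed.

(** None of the functionals [f (x + c *: a)] vanishes at [z]. No two of them are
    proportional, since the difference of the two points is a multiple of [a],
    so that [f a] would be proportional to them too, but it vanishes at [z]. The
    ratio of their values at [y] and [z] is thus an injective function of [c].
    As [K] is finite this function is onto, so it has a zero. *)
Lemma line_meets a x y z :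
  f a y != 0 -> f a z = 0 -> f x z != 0 -> exists c, f (x + c *: a) y = 0.
Proof.
move=> ay az xz.
have nz c : f (x + c *: a) z != 0.
  apply: contra_neq xz => H0.
  by rewrite -[x](addrK (c *: a)); apply: fB => //; apply: fZ.
pose t c := f (x + c *: a) y / f (x + c *: a) z.
have t_inj : injective t.
  move=> c d tcd; apply/eqP; rewrite -subr_eq0; apply: contraNT ay => cd0.
  have t_ker e : t e = t c -> f (x + e *: a) (y - t c *: z) = 0.
    by move=> <-; rewrite scalarBZ divfK ?subrr.
  have := fB (t_ker c erefl) (t_ker d (esym tcd)).
  rewrite opprD addrACA subrr add0r -scalerBl => /(fZK cd0).
  by rewrite scalarBZ az mulr0 subr0 => ->.
have /codomP [c /esym/eqP] := injF_onto t_inj 0.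
by rewrite mulf_eq0 invr_eq0 (negPf (nz c)) orbF => /eqP; exists c.
Qed.

(** Let [x3] have a functional not proportional to that of [x1]. A third
    functional of their pencil occurs at [x1 + x3], and by [line_meets] also at
    some [x2 + c *: x3]. Then [x2 - c *: x1] is both a combination of [x1] and
    [x2] and a combination of those two points, so its functional is a multiple
    of two nonproportional ones: it vanishes. *)
Lemma same_kernel_collinear x1 x2 x3 y1 y3 :
  f x1 y1 != 0 -> f x3 y1 = 0 -> f x3 y3 != 0 -> f x1 y3 = 0 ->
  (forall y, f x1 y = 0 -> f x2 y = 0) ->
  exists c, forall y, f (x2 - c *: x1) y = 0.
Proof.
move=> x1y1 x3y1 x3y3 x1y3 x12; have [r x2E] := scalar_factor x12.
have [r0|r0] := eqVneq r 0.
  by exists 0 => y; rewrite scale0r subr0 x2E r0 mul0r.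
have sy1 : f (x1 + x3) y1 != 0.
  by apply: contra_neq x1y1 => /fB/(_ x3y1); rewrite addrK.
have sy3 : f (x1 + x3) y3 != 0.
  by apply: contra_neq x3y3 => /fB/(_ x1y3); rewrite addrC addKr.
(* y lies in the kernel of f (x1 + x3), but not in those of f x1 and f x3 *)
pose q := f (x1 + x3) y1 / f (x1 + x3) y3; pose y := y1 - q *: y3.
have q0 : q != 0 by rewrite mulf_neq0 ?invr_neq0.
have sy : f (x1 + x3) y = 0 by rewrite scalarBZ divfK ?subrr.
have x3y : f x3 y != 0 by rewrite scalarBZ x3y1 sub0r oppr_eq0 mulf_neq0.
have x1y : f x1 y != 0 by rewrite scalarBZ x1y3 mulr0 subr0.
have [|c x23] := line_meets (x := x2) x3y x3y1; first by rewrite x2E mulf_neq0.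
exists c; have [y' x1y'|s sE] := @scalar_factor _ _ (f x1) (f (x2 - c *: x1)).
  by apply: fB; [apply: x12|apply: fZ].
have : f (x2 - c *: x1) y = 0.
  have -> : x2 - c *: x1 = x2 + c *: x3 - c *: (x1 + x3).
    by rewrite scalerDr opprD addrACA addrA addrK.
  by apply: fB => //; apply: fZ.
rewrite sE => /eqP; rewrite mulf_eq0 (negPf x1y) orbF => /eqP s0 y'.
by rewrite sE s0 mul0r.
Qed.

(** * The affine chart around a base point *)

(** The hypotheses say that [f a] and [f b] are not proportional and not zero;
    [a] is the origin of the chart and functionals are normalized at [y0]. *)
Section Chart.
Variables (a b : V1) (y0 y1 : V2).
Hypotheses (a0 : f a y0 != 0) (b0 : f b y0 = 0) (b1 : f b y1 != 0).

Lemma chart_zero y : f 0 y = 0.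
Proof.
have [y' ay'|s sE] := @scalar_factor _ _ (f a) (f 0).
  by rewrite -(scale0r a); apply: fZ.
have : f 0 y0 = 0 by rewrite -(scale0r b); apply: fZ.
rewrite sE => /eqP; rewrite mulf_eq0 (negPf a0) orbF => /eqP s0.
by rewrite sE s0 mul0r.
Qed.

(** One of [f a] and [f b] is not proportional to [f x]; it supplies the third
    point of [same_kernel_collinear]. *)
Lemma fiber_line x x' : (exists y, f x y != 0) ->
  (forall y, f x y = 0 -> f x' y = 0) ->
  exists c, forall y, f (x' - c *: x) y = 0.
Proof.
move=> [z xz] xx'; have [x0|x0] := eqVneq (f x y0) 0.
- apply: (@same_kernel_collinear _ _ a (z - (f a z / f a y0) *: y0) y0) => //.
  + by rewrite scalarBZ x0 mulr0 subr0.
  + by rewrite scalarBZ divfK ?subrr.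
- apply: (@same_kernel_collinear _ _ b y0 (y1 - (f x y1 / f x y0) *: y0)) => //.
  + by rewrite scalarBZ b0 mulr0 subr0.
  + by rewrite scalarBZ divfK ?subrr.
Qed.

(** The horizontal fiber over [y0] and the line through [a] span [V1]: if [f x]
    and [f a] are not proportional, the line through [x] in direction [a] meets
    the fiber; otherwise [x] is a multiple of [a] modulo the zeros of [f]. *)
Lemma chart_decomposition x : exists c, f (x - c *: a) y0 = 0.
Proof.
have [[z az xz]|ax] := pselect (exists2 z, f a z = 0 & f x z != 0).
  by have [c xc] := line_meets a0 az xz; exists (- c); rewrite scaleNr opprK.
have [||c xc] := @fiber_line a x; first by exists y0.
  by move=> y ay; apply/eqP/negPn/negP => xy; apply: ax; exists y.
by exists c.
Qed.

Lemma chart_coef_unique x c d :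
  f (x - c *: a) y0 = 0 -> f (x - d *: a) y0 = 0 -> c = d.
Proof.
move=> xc xd; apply/eqP; rewrite -subr_eq0; apply: contraNT a0 => cd0.
apply/eqP/(fZK cd0); rewrite scalerBl.
by have := fB xd xc; rewrite opprB addrC addrA subrK.
Qed.

(** Displacement from [a] to [a + u] of the functionals normalized at [y0]. *)
Definition slope (u : V1) (y : V2) : K :=
  f (a + u) y / f (a + u) y0 - f a y / f a y0.

Fact slope_is_scalar u : scalar (slope u).
Proof. by move=> c y z; rewrite /slope !linearP /=; ring. Qed.

HB.instance Definition _ u :=
  GRing.isLinear.Build K V2 K *%R (slope u) (slope_is_scalar u).

Lemma chart_nz u : f u y0 = 0 -> f (a + u) y0 != 0.
Proof. by move=> u0; apply: contra_neq a0 => /fB/(_ u0); rewrite addrK. Qed.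

(** [slope u] and [f u] are both combinations of [f a] and [f (a + u)] that
    vanish at [y0], which determines them up to a scalar. *)
Lemma slope_ker u y : f u y0 = 0 -> (slope u y = 0 <-> f u y = 0).
Proof.
move=> u0; have au0 := chart_nz u0.
(* projecting y to the kernel of f a along y0 changes neither condition *)
pose z := y - (f a y / f a y0) *: y0.
have az : f a z = 0 by rewrite scalarBZ divfK ?subrr.
have uz : f u z = f u y by rewrite scalarBZ u0 mulr0 subr0.
have auz : f (a + u) z = f (a + u) y0 * slope u y.
  by rewrite scalarBZ /slope; field; rewrite a0 au0.
rewrite -uz; split=> [su|uz0].
  have : f (a + u) z = 0 by rewrite auz su mulr0.
  by move=> /fB/(_ az); rewrite addrC addKr.
have := fD az uz0; rewrite auz => /eqP.
by rewrite mulf_eq0 (negPf au0) => /eqP.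
Qed.

(** The point [a + u + v] lies on the line through [a + u] in direction [v], and
    normalization at [y0] fixes the coefficient of the first functional to 1. *)
Lemma slope_step u v : f u y0 = 0 -> f v y0 = 0 ->
  exists t, forall y, slope (u + v) y = slope u y + t * slope v y.
Proof.
move=> u0 v0; have au0 := chart_nz u0; have auv0 := chart_nz (fD u0 v0).
have [y /(slope_ker _ v0) vy|t tE] :=
  @scalar_factor _ _ (slope v) (slope (u + v) \- slope u); last first.
  by exists t => y; rewrite -tE /= [RHS]addrC subrK.
pose q := f (a + u) y / f (a + u) y0; pose z := y - q *: y0.
have auz : f (a + u) z = 0 by rewrite scalarBZ divfK ?subrr.
have vz : f v z = 0 by rewrite scalarBZ v0 mulr0 subr0.
have := fD auz vz; rewrite -addrA scalarBZ => /eqP; rewrite subr_eq0 => /eqP qE.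
by rewrite /= /slope qE mulfK // subrr.
Qed.

(** Parallelogram rule: [slope (u + v)] is both [slope u + t * slope v] and
    [slope v + t' * slope u]; comparing the two at [z] gives [t = 1]. *)
Lemma slopeD_indep u v z : f u y0 = 0 -> f v y0 = 0 ->
  f u z = 0 -> f v z != 0 -> forall y, slope (u + v) y = slope u y + slope v y.
Proof.
move=> u0 v0 uz vz y; have [t uvE] := slope_step u0 v0.
have [t' vuE] := slope_step v0 u0.
have sv : slope v z != 0 by apply: contra_neq vz => /(slope_ker _ v0).
have su : slope u z = 0 by apply/slope_ker.
have := uvE z; rewrite {1}[u + v]addrC vuE su mulr0 addr0 add0r.
rewrite -{1}[slope v z]mul1r.
by move/(mulIf sv) => t1; rewrite uvE -t1 mul1r.
Qed.

Lemma slopeD_ker u v : f u y0 = 0 -> (forall y, f v y = 0) ->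
  forall y, slope (u + v) y = slope u y.
Proof.
move=> u0 vN y; have [t ->] := slope_step u0 (vN y0).
by have -> : slope v y = 0; [apply/slope_ker|rewrite mulr0 addr0].
Qed.

Definition slope_additive := forall u v y, f u y0 = 0 -> f v y0 = 0 ->
  slope (u + v) y = slope u y + slope v y.

(** If [u] and [v] have proportional slopes, a direction [w'] with another slope
    exists, and the parallelogram rule applies to the pairs [(u + v, w')],
    [(u, w')] and [(v, u + w')]; comparing the results gives additivity. *)
Lemma slope_additive_rank3 w z : f w y0 = 0 -> f b z = 0 -> f w z != 0 ->
  slope_additive.
Proof.
move=> w0 bz wz u v y u0 v0.
have [[z' uz' vz']|uv] := pselect (exists2 z', f u z' = 0 & f v z' != 0).
  exact: (slopeD_indep u0 v0 uz' vz').
have {}uv z' : f u z' = 0 -> f v z' = 0.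
  by move=> uz'; apply/eqP/negPn/negP => vz'; apply: uv; exists z'.
have [w' [z' [w'0 uz' w'z']]] : exists w' z',
    [/\ f w' y0 = 0, f u z' = 0 & f w' z' != 0].
  have [uz|uz] := eqVneq (f u z) 0; first by exists w, z.
  exists b, (y1 - (f u y1 / f u z) *: z); split=> //.
    by rewrite scalarBZ divfK ?subrr.
  by rewrite scalarBZ bz mulr0 subr0.
have E1 := slopeD_indep (fD u0 v0) w'0 (fD uz' (uv _ uz')) w'z' y.
have E2 := slopeD_indep u0 w'0 uz' w'z' y.
have uw'z' : f (u + w') z' != 0.
  by apply: contra_neq w'z' => /fB/(_ uz'); rewrite addrC addKr.
have E3 := slopeD_indep v0 (fD u0 w'0) (uv _ uz') uw'z' y.
move: E1; rewrite addrAC addrC E3 E2 => E1.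
by apply: (addIr (slope w' y)); rewrite -E1; ring.
Qed.

(** The nonzero functionals [f x] then form, up to scalars, a single projective
    line. *)
Definition chart_rank2 := forall w z, f w y0 = 0 -> f b z = 0 -> f w z = 0.

Lemma rank2_decomposition (rank2 : chart_rank2) w :
  f w y0 = 0 -> exists d, forall y, f (w - d *: b) y = 0.
Proof.
by move=> w0; apply: fiber_line => [|z]; [exists y1|apply: rank2].
Qed.

(** Here [slope (c *: b) = t c * slope b] with [t] fixing 0 and 1. Equal values
    of [t] at [c] and [d] would give [a + c *: b] and [a + d *: b] the same
    normalized functional, so [t] is injective, hence the identity. *)
Lemma slope_additive_small : (#|K| <= 3)%N -> chart_rank2 -> slope_additive.
Proof.
move=> K3 rank2.
have cb0 c : f (c *: b) y0 = 0 by apply: fZ.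
have [t tE] : exists t : K -> K, forall c y, slope (c *: b) y = t c * slope b y.
  have /choice [t tE] : forall c, exists t, forall y,
      slope (c *: b) y = t * slope b y.
    move=> c; apply: scalar_factor => y /(slope_ker _ b0) bY.
    by apply/slope_ker => //; apply: fZ.
  by exists t.
have sb1 : slope b y1 != 0 by apply: contra_neq b1 => /(slope_ker _ b0).
have t_id : t =1 id.
  apply: small_field_inj_id => //.
  - move=> c d tcd; apply/eqP; rewrite -subr_eq0; apply: contraNT b1 => cd0.
    have := tE c y1; rewrite tcd -tE /slope => /addIr cdE.
    pose q := f (a + c *: b) y1 / f (a + c *: b) y0.
    have cz : f (a + c *: b) (y1 - q *: y0) = 0.
      by rewrite scalarBZ divfK ?subrr ?chart_nz.
    have dz : f (a + d *: b) (y1 - q *: y0) = 0.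
      by rewrite scalarBZ /q cdE divfK ?subrr ?chart_nz.
    have := fB cz dz; rewrite opprD addrACA subrr add0r -scalerBl => /(fZK cd0).
    by rewrite scalarBZ b0 mulr0 subr0 => ->.
  - apply: (mulIf sb1); rewrite mul0r -tE; apply/slope_ker => //.
    by rewrite scale0r; apply: chart_zero.
  - by apply: (mulIf sb1); rewrite mul1r -tE scale1r.
have slope_coord c w : (forall y, f w y = 0) ->
    forall y, slope (c *: b + w) y = c * slope b y.
  by move=> wN y; rewrite slopeD_ker // tE t_id.
move=> u v y u0 v0.
have [c uN] := rank2_decomposition rank2 u0.
have [d vN] := rank2_decomposition rank2 v0.
have -> : u + v = (c + d) *: b + ((u - c *: b) + (v - d *: b)).
  by rewrite scalerDl addrACA ![_ *: b + _]addrC !subrK.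
rewrite slope_coord; last by move=> y'; apply: fD.
rewrite -[u in RHS](subrK (c *: b)) -[v in RHS](subrK (d *: b)).
by rewrite ![_ + _ *: b]addrC !slope_coord // mulrDl.
Qed.

(** Over a prime field an additive [slope] is linear. The kernel of the form at
    [x] is the right one because a point off the horizontal fiber over [y0] is a
    multiple of a point of the chart. *)
Lemma bilinear_of_slope_additive :
  (forall c : K, exists n, c = n%:R) -> slope_additive ->
  exists M : {bilinear V1 -> V2 -> K | *%R & *%R},
    forall x y, M x y = 0 <-> f x y = 0.
Proof.
move=> K_prime sD.
have sZ c u y : f u y0 = 0 -> slope (c *: u) y = c * slope u y.
  have [n ->] := K_prime c; move=> u0; rewrite scaler_nat mulr_natl.
  elim: n => [|n IHn].
    rewrite !mulr0n; apply: (addIr (slope u y)); rewrite -sD ?add0r //.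
    by rewrite -(scale0r u); apply: fZ.
  by rewrite !mulrS sD ?IHn //; rewrite -scaler_nat; apply: fZ.
have [k kE] := choice chart_decomposition.
have kP c x x' : k (c *: x + x') = c * k x + k x'.
  apply: (@chart_coef_unique (c *: x + x')) => //.
  have -> : c *: x + x' - (c * k x + k x') *: a
          = c *: (x - k x *: a) + (x' - k x' *: a).
    by rewrite scalerDl scalerBr scalerA opprD addrACA.
  by apply: fD => //; apply: fZ.
pose B x y := k x * (f a y / f a y0) + slope (x - k x *: a) y.
have B_bil : bilinear_for *%R *%R B.
  split=> [y c x x'|x c y y']; rewrite /B /=.
    have -> : c *: x + x' - k (c *: x + x') *: a
          = c *: (x - k x *: a) + (x' - k x' *: a).
      by rewrite kP scalerDl scalerBr scalerA opprD addrACA.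
    rewrite sD ?sZ ?kP //; last by apply: fZ.
    by ring.
  by rewrite !linearP /=; ring.
have [M ME] := bilinear_of_bilinear_for B_bil.
exists M => x y; rewrite ME /B.
have [k0|k0] := eqVneq (k x) 0.
  rewrite k0 mul0r add0r scale0r subr0; apply: slope_ker.
  by have := kE x; rewrite k0 scale0r subr0.
pose u := (k x)^-1 *: (x - k x *: a).
have u0 : f u y0 = 0 by apply: fZ.
have xE : x = k x *: (a + u).
  by rewrite scalerDr scalerA mulfV // scale1r addrC subrK.
have -> : x - k x *: a = k x *: u by rewrite scalerA mulfV // scale1r.
rewrite sZ // -mulrDr /slope [X in _ * X]addrC subrK.
have au0 := chart_nz u0.
rewrite [f x y](_ : _ = f (k x *: (a + u)) y); last by rewrite -xE.
split=> [/eqP|/(fZK k0) ->]; last by rewrite mul0r mulr0.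
rewrite !mulf_eq0 invr_eq0 (negPf k0) (negPf au0) orbF /= => /eqP.
exact: fZ.
Qed.

(** The points [a] and [b] form a basis modulo the zeros of [f], and any left
    factor consists of zeros of [f]. *)
Lemma min_left_codim_rank2 :
  chart_rank2 -> min_left_codim [set z | f z.1 z.2 = 0] 2.
Proof.
move=> rank2; split.
- exists [set x | forall y, f x y = 0].
    split; last by move=> [x y] [/= xN _].
    split; first by apply/mem_set => y /=; apply: chart_zero.
    move=> c x x'; rewrite !inE /= => xN x'N y; apply: fD => //.
    exact: fZ.
  exists (fun i => if i == 0 then a else b) => v.
  have [c vc] := chart_decomposition v.
  have [d vd] := rank2_decomposition rank2 vc.
  exists (\row_i (if i == 0 then c else d)); split.
    move=> y; rewrite !big_ord_recl big_ord0 !mxE /= addr0 opprD addrA.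
    exact: vd.
  move=> r rN.
  have rE y : f (v - r 0 0 *: a - r 0 1 *: b) y = 0.
    have := rN y; rewrite !big_ord_recl big_ord0 /= addr0 opprD addrA.
    by rewrite (_ : lift _ _ = 1) //; apply/val_inj.
  have cE : c = r 0 0.
    apply: (chart_coef_unique vc).
    rewrite -[_ - _](subrK (r 0 1 *: b)); apply: fD => //; exact: fZ.
  have dE : d = r 0 1.
    apply/eqP; rewrite -subr_eq0; apply: contraNT b1 => dr0.
    apply/eqP/(fZK dr0); rewrite scalerBl.
    have := fB (rE y1) (vd y1).
    by rewrite cE opprD opprK addrACA subrr add0r addrC.
  apply/rowP => i; rewrite mxE.
  case: eqP => [-> //|i0]; rewrite dE; congr (r _ _).
  by apply/val_inj; case: i i0 => [[|[|]]] // ? []; apply/val_inj.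
- move=> W [|[|k]] // [_ WP] [e eP].
    have [c [+ _]] := eP a; rewrite big_ord0 subr0 => Wa.
    have /= ay0 := WP (a, y0) (conj Wa I).
    by move: a0; rewrite ay0 eqxx.
  have [c [+ _]] := eP a; rewrite big_ord_recl big_ord0 addr0 => Wa.
  have [d [+ _]] := eP b; rewrite big_ord_recl big_ord0 addr0 => Wb.
  set e0 := e _ in Wa Wb; set c0 := c _ _ in Wa; set d0 := d _ _ in Wb.
  have aN y : f (a - c0 *: e0) y = 0 := WP (a - c0 *: e0, y) (conj Wa I).
  have bN y : f (b - d0 *: e0) y = 0 := WP (b - d0 *: e0, y) (conj Wb I).
  have abN y : f (d0 *: a - c0 *: b) y = 0.
    have -> : d0 *: a - c0 *: b
        = d0 *: (a - c0 *: e0) - c0 *: (b - d0 *: e0).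
      by rewrite !scalerBr !scalerA opprB [c0 * d0]mulrC addrA subrK.
    by apply: fB; apply: fZ.
  have d00 : d0 = 0.
    apply/eqP; apply: contraNT a0 => d00; apply/eqP/(fZK d00).
    by have := fD (abN y0) (fZ c0 b0); rewrite subrK.
  have := bN y1; rewrite d00 scale0r subr0 => by1.
  by move: b1; rewrite by1 eqxx.
Qed.

End Chart.
End Incidence.

(** * Fibers as kernels *)

Section CodimensionOne.
Variables (K : fieldType) (V : lmodType K).

(** In codimension 1 the functional is the coordinate along the vector that
    spans the quotient; it is linear because the coordinate is unique. *)
Lemma functional_of_codim_le1 (H : set V) : subspace H -> codim_le H 1 ->
  exists g : {scalar V}, forall v, H v <-> g v = 0.
Proof.
move=> [/set_mem H0 HL] [[|[|k]]] // _ [e eP].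
  have g_lin : scalar (fun _ : V => 0 : K) by move=> c u v; rewrite mulr0 addr0.
  pose g : {scalar V} :=
    HB.pack (fun _ : V => 0 : K) (GRing.isLinear.Build K V K *%R _ g_lin).
  exists g => v; split=> // _.
  by have [c [+ _]] := eP v; rewrite big_ord0 subr0.
have {}HL c u v : H u -> H v -> H (c *: u + v).
  by move=> /mem_set Hu /mem_set Hv; apply/set_mem/HL.
have eE v (c : 'rV[K]_1) : v - \sum_(i < 1) c 0 i *: e i = v - c 0 0 *: e 0.
  by rewrite big_ord_recl big_ord0 addr0.
have uniq_c v c d : H (v - c *: e 0) -> H (v - d *: e 0) -> c = d.
  move=> vc vd; have [r [_ r_uniq]] := eP v.
  have rE q : H (v - q *: e 0) -> q = r 0 0.
    by move=> vq; rewrite (r_uniq (const_mx q)) ?mxE // eE mxE.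
  by rewrite (rE c) // (rE d).
have /choice [g gE] v : exists c, H (v - c *: e 0).
  by have [c [+ _]] := eP v; rewrite eE; exists (c 0 0).
have g_lin : scalar g.
  move=> c u v; apply: (@uniq_c (c *: u + v)) => //.
  have -> : c *: u + v - (c * g u + g v) *: e 0
      = c *: (u - g u *: e 0) + (v - g v *: e 0).
    by rewrite scalerDl scalerBr scalerA opprD addrACA.
  exact: HL.
pose h : {scalar V} := HB.pack g (GRing.isLinear.Build K V K *%R g g_lin).
exists h => v; split=> [Hv|gv].
  by apply: (@uniq_c v) => //; rewrite scale0r subr0.
by have := gE v; rewrite [g v]gv scale0r subr0.
Qed.

End CodimensionOne.

(** A positive multiple is asked for, so that closure under addition alone
    gives closure under every scalar, 0 included. *)
Lemma Fp_natr (p : nat) (c : 'F_p) : prime p -> exists n, c = n.+1%:R.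
Proof.
move=> p_prime; exists (c + p.-1)%N.
by rewrite -addnS prednK ?prime_gt0 // natrD pchar_Fp_0 // addr0 natr_Zp.
Qed.

(** * The three alternatives *)

Theorem proposition3p4 (p : nat) (p_prime : prime p)
    (V1 V2 : lmodType 'F_p) (P : set (V1 * V2))
    (P_transverse : transverse P)
    (P_fibers : forall x : V1,
       subspace (xsection P x) /\ codim_le (xsection P x) 1) :
  [\/ exists (W : set V1) (H : set V2),
        [/\ W = set0 \/ subspace W, hyperplane H &
            P = (W `*` [set: V2]) `|` ([set: V1] `*` H)],
      exists b : {bilinear V1 -> V2 -> 'F_p | *%R & *%R},
        P = [set z | b z.1 z.2 = 0]
    | (5 <= p)%N /\ min_left_codim P 2].
Proof.
have /choice [f fE] x : exists g : {scalar V2},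
    forall y, xsection P x y <-> g y = 0.
  by have [? ?] := P_fibers x; apply: functional_of_codim_le1.
have {}fE x y : P (x, y) <-> f x y = 0.
  by rewrite -fE; split=> [/mem_set|/set_mem].
have PE : P = [set z | f z.1 z.2 = 0].
  by apply/seteqP; split=> -[x y] /fE.
have fD x x' y : f x y = 0 -> f x' y = 0 -> f (x + x') y = 0.
  move=> /fE xy /fE x'y; apply/fE; rewrite -P_transverse.2.
  by exists x, x'.
have fZ (c : 'F_p) x y : f x y = 0 -> f (c *: x) y = 0.
  have [n ->] := Fp_natr c p_prime; rewrite scaler_nat => xy.
  by elim: n => // n IHn; rewrite mulrS; apply: fD.
have natF (c : 'F_p) : exists n, c = n%:R.
  by have [n ->] := Fp_natr c p_prime; exists n.+1.
have [[a [b [y0 [y1 [a0 b0 b1]]]]]|par] := pselect (exists a b y0 y1,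
    [/\ f a y0 != 0, f b y0 = 0 & f b y1 != 0]).
  have bil : slope_additive f a y0 ->
      exists M : {bilinear V1 -> V2 -> 'F_p | *%R & *%R},
        P = [set z | M z.1 z.2 = 0].
    case/(bilinear_of_slope_additive fD fZ a0 b0 b1 natF) => M ME.
    by exists M; rewrite PE; apply/seteqP; split=> z /ME.
  have [[w [z [w0 bz wz]]]|rank2] := pselect (exists w z,
      [/\ f w y0 = 0, f b z = 0 & f w z != 0]).
    by apply: Or32; apply/bil/(slope_additive_rank3 fD fZ a0 b0 b1 w0 bz wz).
  have {}rank2 : chart_rank2 f b y0.
    move=> w z w0 bz; apply/eqP/negPn/negP => wz.
    by apply: rank2; exists w, z.
  have [p5|p5] := leqP 5 p.
    apply: Or33; split=> //; rewrite PE.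
    exact: (min_left_codim_rank2 fD fZ a0 b0 b1).
  apply: Or32; apply: bil; apply: (slope_additive_small fD fZ a0 b0 b1) => //.
  (* the bound is p <= 3, because 4 is not prime *)
  rewrite card_Fp // -ltnS ltn_neqAle -ltnS p5 andbT.
  by apply: contraTneq p_prime => ->.
have {}par a b y : f b y = 0 -> (exists z, f b z != 0) -> f a y = 0.
  move=> b_y [z bz]; apply/eqP/negPn/negP => ay; apply: par.
  by exists a, b, y, z.
have [[a [y0 a0]]|fN] := pselect (exists a y, f a y != 0); last first.
  have f0 x y : f x y = 0.
    by apply/eqP/negPn/negP => xy; apply: fN; exists x, y.
  have [|M ME] := @bilinear_of_bilinear_for _ V1 V2 (fun _ _ => 0 : 'F_p).
    by split=> [y c x x'|x c y y'] /=; rewrite mulr0 addr0.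
  apply: Or32; exists M; rewrite PE; apply/seteqP.
  by split=> z _ /=; [apply: ME|apply: f0].
apply: Or31; exists [set x | forall y, f x y = 0], (xsection P a); split.
- have [[w wN]|W0] := pselect (exists w, forall y, f w y = 0); last first.
    by left; apply/seteqP; split=> // x xN; apply: W0; exists x.
  right; split.
    by apply/mem_set => y; rewrite -(scale0r w); apply: fZ.
  by move=> c x x'; rewrite !inE => xN x'N y; apply: fD => //; apply: fZ.
- have [Psub Pcodim] := P_fibers a; split=> //.
  case: Pcodim => -[|[|k]] // _ [e eP].
  have [c [+ _]] := eP y0; rewrite big_ord0 subr0.
  by move=> /set_mem/fE ay; rewrite ay eqxx in a0.
- apply/seteqP; split=> [[x y] /fE xy|[x y]].
    have [[z xz]|xN] := pselect (exists z, f x z != 0).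
      by right; split=> //; apply/mem_set/fE/(par _ x) => //; exists z.
    left; split=> // z.
    by apply/eqP/negPn/negP => xz; apply: xN; exists z.
  case=> [[xN _]|[_ /set_mem/fE ay]]; apply/fE; first exact: xN.
  by apply: (par _ a) => //; exists y0.
Qed.
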